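(* Let $G$ be a non-cyclic finite abelian group. Then the $G$-transfer system $\langle (0,G)\rangle$ generated by the single pair $(0,G)$ (where $0$ is the trivial subgroup) is not realized by a $G$-Steiner operad or a $G$-linear isometries operad; that is, for every $G$-universe $U$, $\langle (0,G)\rangle\neq\ \to_{\mathcal{K}(U)}$ and $\langle (0,G)\rangle\neq\ \to_{\mathcal{L}(U)}$.
   Context: Let $G$ be a finite group and $\mathrm{Sub}(G)$ its set of subgroups. A $G$-transfer system is a partial order $\to$ on $\mathrm{Sub}(G)$ such that: if $K\to H$ then $K\subset H$; if $K\to H$ then $gKg^{-1}\to gHg^{-1}$ for all $g\in G$; if $K\to H$ and $L\subset H$ then $K\cap L\to L$. For a binary relation $R$ on $\mathrm{Sub}(G)$ refining inclusion (identified with its set of related pairs), $\langle R\rangle$ is the smallest $G$-transfer system containing $R$. A $G$-universe is a countably infinite dimensional real inner product space $U$ with a linear isometric $G$-action, which contains each of its (finite dimensional) subrepresentations infinitely often, and which contains trivial summands. Linear isometries operad: $\mathcal{L}(U)(n)$ is the $G\times\Sigma_n$-space of all linear, not necessarily equivariant, isometries $U^{\oplus n}\hookrightarrow U$ ($G$ acts by conjugation, $\Sigma_n$ by permuting summands). Steiner operad: for a finite dimensional real orthogonal $G$-representation $V$, let $R_V$ be the $G$-space (under conjugation) of distance-reducing, not necessarily equivariant, embeddings $V\to V$. A $V$-Steiner path is a map $h:[0,1]\to R_V$ with $h(1)=\mathrm{id}$, and $\mathcal{K}(V)(n)$ is the $G\times\Sigma_n$-space of $n$-tuples $(h_1,\dots,h_n)$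 of $V$-Steiner paths such that the images of $h_1(0),\dots,h_n(0)$ are disjoint. Set $\mathcal{K}(U)=\mathrm{colim}_{V\subset U}\mathcal{K}(V)$, over finite dimensional subrepresentations $V\subset U$ (for $V\subset W$ one takes the product with the identity on the orthogonal complement of $V$ in $W$). For $\mathcal{O}=\mathcal{K}(U)$ or $\mathcal{L}(U)$ and $K\subset H\subset G$ with $n=|H:K|$, let $\Gamma(H/K)=\{(h,\sigma(h))\mid h\in H\}\subset G\times\Sigma_n$ be the graph of a permutation representation $\sigma:H\to\Sigma_n$ of $H/K$. The transfer system $\to_{\mathcal{O}}$ is defined by: $K\to_{\mathcal{O}}H$ iff $K\subset H$ and $\mathcal{O}(n)^{\Gamma(H/K)}\neq\varnothing$. By known theorems of Blumberg and Hill, for $K\subset H$: $K\to_{\mathcal{K}(U)}H$ iff there is an injective $H$-equivariant map of sets $H/K\hookrightarrow\mathrm{res}^G_HU$, and $K\to_{\mathcal{L}(U)}H$ iff there is an $H$-equivariant linear embedding $\mathrm{ind}_K^H\mathrm{res}^G_KU\hookrightarrow\mathrm{res}^G_HU$. *)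

(* Defs.v *)
From HB Require Import structures.
From mathcomp Require Import all_boot all_order all_algebra all_fingroup all_solvable.
From mathcomp Require Import sesquilinear.
From mathcomp Require Import all_classical all_reals all_analysis.

Set Implicit Arguments.
Unset Strict Implicit.
Unset Printing Implicit Defensive.

Import Order.TTheory GRing.Theory Num.Theory.
Import numFieldNormedType.Exports.

Local Open Scope classical_set_scope.
Local Open Scope ring_scope.

(* The ambient group G is the whole of a finGroupType gT, so Sub(G) is
   {group gT}.  In MathComp K :^ g is g^-1 K g, so that g K g^-1 is
   K :^ g^-1. *)

Section TransferSystems.
Variable gT : finGroupType.
Implicit Types (K H L : {group gT}) (T S : {group gT} -> {group gT} -> Prop).

Record transfer_system T : Prop := TransferSystem {
  ts_refl : forall H, T H H;
  ts_antisym : forall K H, T K H -> T H K -> K = H;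
  ts_trans : forall L K H, T L K -> T K H -> T L H;
  ts_sub : forall K H, T K H -> K \subset H;
  ts_conj : forall K H (g : gT), T K H -> T (K :^ g^-1)%G (H :^ g^-1)%G;
  ts_res : forall K H L, T K H -> L \subset H -> T (K :&: L)%G L
}.

Definition transfer_generated S : {group gT} -> {group gT} -> Prop :=
  fun K H => forall T, transfer_system T ->
    (forall K' H', S K' H' -> T K' H') -> T K H.

Lemma transfer_generated_min S T : transfer_system T ->
  (forall K H, S K H -> T K H) -> forall K H, transfer_generated S K H -> T K H.
Proof. by move=> tsT sST K H; apply. Qed.

Lemma sub_transfer_generated S K H : S K H -> transfer_generated S K H.
Proof. by move=> SKH T _; apply. Qed.

Lemma transfer_system_subset :
  transfer_system (fun K H => is_true (K \subset H)).
Proof.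
split=> //.
- by move=> K H KH HK; apply/val_inj/eqP; rewrite finset.eqEsubset KH.
- by move=> L K H LK KH; apply: (fintype.subset_trans LK KH).
- by move=> K H g KH; rewrite /= conjSg.
- by move=> K H L _ _; rewrite /= subsetIr.
Qed.

Lemma transfer_generatedP S :
  (forall K H, S K H -> K \subset H) -> transfer_system (transfer_generated S).
Proof.
move=> refS; have sub K H : transfer_generated S K H -> K \subset H.
  by apply: transfer_generated_min refS K H; apply: transfer_system_subset.
split=> //.
- by move=> H T tsT _; apply: ts_refl.
- move=> K H /sub KH /sub HK; apply: ts_antisym KH HK.
  exact: transfer_system_subset.
- by move=> L K H LK KH T tsT sT; apply: (ts_trans tsT) (LK T tsT sT) (KH T tsT sT).
- by move=> K H g KH T tsT sT; apply: (ts_conj tsT); apply: KH.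
- by move=> K H L KH LH T tsT sT; apply: (ts_res tsT) LH; apply: KH.
Qed.

Definition pair_relation K H : {group gT} -> {group gT} -> Prop :=
  fun K' H' => K' = K /\ H' = H.

End TransferSystems.

(* The part of a G-operad that its transfer system depends on: in each arity a
   set of points gs_pts, carved out of a type, and the action on it of
   (g, s) in G x Sigma_n.  Here Sigma_n multiplies by composition of functions,
   (s t)(i) = s (t i), which is opposite to the product of 'S_n, and
   G x Sigma_n acts from the left. *)
Record G_symmetric_sequence (gT : finGroupType) := GSymmetricSequence {
  gs_type : nat -> Type;
  gs_pts : forall n, set (gs_type n);
  gs_act : forall n, gT -> 'S_n -> gs_type n -> gs_type n
}.

Section OperadTransfer.
Variables (gT : finGroupType) (O : G_symmetric_sequence gT).
Implicit Types K H : {group gT}.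

(* sigma describes the left action of H on H/K = {xK | x in H} after some
   enumeration e of H/K. *)
Definition is_coset_perm_rep K H n (sigma : gT -> 'S_n) : Prop :=
  exists e : 'I_n -> {set gT},
    [/\ injective e,
        (forall C, (exists i, e i = C) <-> C \in lcosets K H) &
        forall h i, h \in H -> e (sigma h i) = (h *: e i)%g].

Definition graph_subgroup H n (sigma : gT -> 'S_n) : set (gT * 'S_n) :=
  [set (h, sigma h) | h in [set` H]].

Definition fixed_pts n (Gamma : set (gT * 'S_n)) : set (gs_type O n) :=
  [set x | gs_pts x /\ forall gs, Gamma gs -> gs_act gs.1 gs.2 x = x].

Definition operad_transfer K H : Prop :=
  K \subset H /\
  exists sigma : gT -> 'S_(#|H : K|%g),
    is_coset_perm_rep K H sigma /\ fixed_pts (graph_subgroup H sigma) !=set0.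

End OperadTransfer.

(* An inner product space is a normed module whose norm comes from an inner
   product; its topology is the norm topology. *)
Record orth_rep (R : realType) (gT : finGroupType) := OrthRep {
  rep_space :> normedModType R;
  rep_dot : {dot rep_space for idfun};
  rep_norm : forall u, `|u| ^+ 2 = rep_dot u u;
  rep_act : gT -> rep_space -> rep_space;
  rep_act1 : forall u, rep_act 1%g u = u;
  rep_actM : forall g h u, rep_act (g * h)%g u = rep_act g (rep_act h u);
  rep_act_linear : forall g, linear (rep_act g);
  rep_act_isometry : forall g u v,
    rep_dot (rep_act g u) (rep_act g v) = rep_dot u v
}.

Section Universes.
Variables (R : realType) (gT : finGroupType) (U : orth_rep R gT).

Record fd_subrep := FdSubrep {
  subrep_set :> set U;
  subrep_span : exists n (b : 'I_n -> U),
    subrep_set = [set \sum_(i < n) c i *: b i | c in [set: 'I_n -> R]];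
  subrep_stable : forall g u, subrep_set u -> subrep_set (rep_act g u)
}.

(* Countable dimension in the algebraic sense: there is a basis indexed by
   nat. *)
Definition countably_infinite_dim : Prop :=
  exists e : nat -> U,
    (forall u, exists n (c : nat -> R), u = \sum_(i < n) c i *: e i) /\
    (forall n (c : nat -> R), \sum_(i < n) c i *: e i = 0 ->
       forall i, (i < n)%N -> c i = 0).

(* phi k, for k in nat, are equivariant linear isometric embeddings of V with
   pairwise orthogonal images.  Their values outside V are irrelevant. *)
Definition contains_infinitely_often (V : fd_subrep) : Prop :=
  exists phi : nat -> U -> U,
    [/\ forall k a u v, subrep_set V u -> subrep_set V v ->
          phi k (a *: u + v) = a *: phi k u + phi k v,
        forall k g u, subrep_set V u ->
          phi k (rep_act g u) = rep_act g (phi k u) &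
        forall k l u v, subrep_set V u -> subrep_set V v ->
          rep_dot U (phi k u) (phi l v) = if k == l then rep_dot U u v else 0].

Record G_universe : Prop := GUniverse {
  univ_dim : countably_infinite_dim;
  univ_inf : forall V : fd_subrep, contains_infinitely_often V;
  univ_triv : exists2 u : U, u != 0 & forall g, rep_act g u = u
}.

Definition lin_isom_pts n : set ({ffun 'I_n -> U} -> U) :=
  [set f : {ffun 'I_n -> U} -> U | linear f /\
     forall x y, rep_dot U (f x) (f y) = \sum_(i < n) rep_dot U (x i) (y i)].

(* f |-> g o f o (g, s)^-1, where s moves the i-th summand of U^n to the
   (s i)-th one. *)
Definition lin_isom_act n (g : gT) (s : 'S_n) (f : {ffun 'I_n -> U} -> U) :
    {ffun 'I_n -> U} -> U :=
  fun x => rep_act g (f [ffun i => rep_act g^-1%g (x (s i))]).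

Definition lin_isom_operad : G_symmetric_sequence gT :=
  GSymmetricSequence lin_isom_pts lin_isom_act.

Definition unit_itv : set R := `[0, 1].

Lemma unit_itv0 : 0 \in unit_itv.
Proof. by rewrite inE /unit_itv /= in_itv /= lexx ler01. Qed.

Lemma unit_itv1 : 1 \in unit_itv.
Proof. by rewrite inE /unit_itv /= in_itv /= lexx ler01. Qed.

Definition itv0 : unit_itv := exist _ 0 unit_itv0.
Definition itv1 : unit_itv := exist _ 1 unit_itv1.

Definition topological_embedding (X Y : topologicalType) (f : X -> Y) : Prop :=
  [/\ injective f, continuous f &
      forall A : set X, open A ->
        exists2 B : set Y, open B & f @` A = B `&` range f].

Definition distance_reducing (V : fd_subrep) (f : V -> V) : Prop :=
  forall v w : V, `|val (f v) - val (f w)| <= `|val v - val w|.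

Definition steiner_maps (V : fd_subrep) : set (V -> V) :=
  [set f | topological_embedding f /\ distance_reducing f].

(* steiner_maps V is topologized as a subspace of the space of all maps with
   the compact-open topology. *)
Definition steiner_path (V : fd_subrep) (h : unit_itv -> V -> V) : Prop :=
  [/\ forall t, steiner_maps (h t),
      continuous (h : unit_itv -> {compact-open, V -> V}) &
      h itv1 = id].

Definition steiner_pts (V : fd_subrep) n : set ('I_n -> unit_itv -> V -> V) :=
  [set h | (forall i, steiner_path (h i)) /\
           forall i j, i != j ->
             range (h i itv0) `&` range (h j itv0) = set0].

Definition subrep_act (V : fd_subrep) (g : gT) (v : V) : V :=
  exist _ (rep_act g (val v)) (mem_set (subrep_stable g (set_mem (valP v)))).

Definition steiner_act (V : fd_subrep) n (g : gT) (s : 'S_n)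
    (h : 'I_n -> unit_itv -> V -> V) : 'I_n -> unit_itv -> V -> V :=
  fun i t v => subrep_act g (h ((s^-1)%g i) t (subrep_act g^-1%g v)).

(* For V `<=` W, F is the product of f with the identity of the orthogonal
   complement of V in W. *)
Definition is_stabilization (V W : fd_subrep) (f : V -> V) (F : W -> W) :=
  forall (v : V) (w : U) (x : W),
    (forall v' : V, rep_dot U (val v') w = 0) ->
    val x = val v + w -> val (F x) = val (f v) + w.

(* Write K(V)(n) for steiner_pts V n.  The points of the Steiner operad K(U) in
   arity n are those of the colimit of the K(V)(n) over the finite dimensional
   subrepresentations V of U: classes of pairs (V, h) with h in K(V)(n), where (V, h) and
   (W, k) are equivalent when h and k have the same image in some K(Z)(n). *)
Definition steiner_germ n := {V : fd_subrep & 'I_n -> unit_itv -> V -> V}.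

Definition germ_pts n : set (steiner_germ n) := [set a | steiner_pts (projT2 a)].

Definition germ_equiv n (a b : steiner_germ n) : Prop :=
  exists (Z : fd_subrep) (z : 'I_n -> unit_itv -> Z -> Z),
    [/\ projT1 a `<=` Z, projT1 b `<=` Z, steiner_pts z,
        forall i t, is_stabilization (projT2 a i t) (z i t) &
        forall i t, is_stabilization (projT2 b i t) (z i t)].

Definition steiner_colim_pts n : set (set (steiner_germ n)) :=
  [set P | exists2 a, germ_pts a & P = [set b | germ_pts b /\ germ_equiv a b]].

Definition steiner_colim_act n (g : gT) (s : 'S_n)
    (P : set (steiner_germ n)) : set (steiner_germ n) :=
  [set existT _ (projT1 a) (steiner_act g s (projT2 a)) | a in P].

Definition steiner_operad : G_symmetric_sequence gT :=
  GSymmetricSequence steiner_colim_pts steiner_colim_act.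

End Universes.

(* Main.v *)
Require Import Defs.
From mathcomp Require Import all_boot all_order all_algebra all_fingroup all_solvable.
From mathcomp Require Import sesquilinear ring lra.
From mathcomp Require Import all_classical all_reals all_analysis.

Set Implicit Arguments.
Unset Strict Implicit.
Unset Printing Implicit Defensive.

Import Order.TTheory GRing.Theory Num.Theory.
Import numFieldNormedType.Exports.

Local Open Scope classical_set_scope.
Local Open Scope ring_scope.

(** The transfer system generated by 1 -> G is tiny: a relation K -> H in it has
    K = H or K = 1.  So it is enough to show that, for either operad, 1 -> G
    forces some K -> H with 1 < K < H.

    Linear isometries.  A point of arity |G| fixed by the graph of the regular
    representation is an equivariant isometry from a direct sum of |G| copies
    of U, permuted by G, to U.  Precomposing it with the rescaled diagonal
    embedding of the sum over G/K yields a fixed point of arity |G : K|, so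
    that K -> G for every subgroup K (lin_isom_transfer_saturated).  A
    noncyclic G has a subgroup with 1 < K < G, namely any nontrivial cyclic one.

    Steiner.  K -> H holds if and only if some u in U has stabilizer K in H.
    Given a fixed point of K(U), the centres h_i(0)(0) of the embeddings are
    distinct and permuted by H like H/K (steiner_transfer_stabilizer).
    Conversely, around the orbit of u, one can shrink the span of G u
    equivariantly into disjoint balls (stabilizer_steiner_transfer).

    It remains to find, from a u with trivial stabilizer, a vector with an
    intermediate one.  As G is abelian and not cyclic, it contains an elementary
    abelian p-group E of order p^2.  For x in E, the sum N_x of the vectors
    x^i u for i < p is fixed by x.  If each N_x with x <> 1 were fixed by the
    whole of E, then so would be their sum, which is (|E| - p) u plus a multiple
    of the sum of the orbit E u, and then u itself would be fixed by E.  So the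
    stabilizer K in E of some N_x satisfies 1 < K < E
    (intermediate_stabilizer). *)

(** * Generated transfer systems and permutation representations of coset spaces *)

Section Generated.
Variable gT : finGroupType.
Implicit Types K H L : {group gT}.

(** The relations on the right already form a transfer system, since 1 is
    normal and restricting 1 -> H to a subgroup C gives 1 -> C. *)
Lemma transfer_generated_trivial L K H :
  transfer_generated (pair_relation 1%G L) K H -> K = H \/ K = 1%G.
Proof.
have eq1 (A : {group gT}) : A \subset 1%G -> A = 1%G.
  by move=> A1; apply/val_inj/trivgP.
apply: (@transfer_generated_min _ _ (fun K H : {group gT} => K = H \/ K = 1%G)).
  split.
  - by move=> A; left.
  - move=> A B [->//|->] [->//|->//].
  - by move=> A B C [->//|->]; right.
  - by move=> A B [->//|->]; exact: sub1G.
  - move=> A B g [->|->]; first by left.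
    by right; apply: eq1; rewrite /= conjs1g.
  - move=> A B C [->|->] sC; last by right; apply: eq1; rewrite /= finset.subsetIl.
    by left; apply/val_inj/finset.setIidPr.
by move=> A B [-> ->]; right.
Qed.

Section CosetRep.
Variables K H : {group gT}.

Lemma coset_perm_rep_exists :
  exists sigma : gT -> 'S_(#|H : K|%g), is_coset_perm_rep K H sigma.
Proof.
have card_eq : #|lcosets K H| = #|H : K|%g := card_lcosets H K.
pose e (i : 'I_(#|H : K|%g)) : {set gT} := enum_val (cast_ord (esym card_eq) i).
have e_in i : e i \in lcosets K H by exact: enum_valP.
have e_inj : injective e.
  by move=> i j /enum_val_inj/cast_ord_inj.
have e_onto C : C \in lcosets K H -> exists i, e i = C.
  move=> CH; exists (cast_ord card_eq (enum_rank_in CH C)).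
  by rewrite /e cast_ordK enum_rankK_in.
have mulH h i : h \in H -> (h *: e i)%g \in lcosets K H.
  move=> hH; have /lcosetsP[x xH ->] := e_in i.
  by apply/lcosetsP; exists (h * x)%g; rewrite ?groupM ?lcosetM.
have sigma_ex h : exists s : 'S_(#|H : K|%g),
    h \in H -> forall i, e (s i) = (h *: e i)%g.
  have [hH|hH] := boolP (h \in H); last by exists 1%g.
  have /choice[f fE] : forall i, exists j, e j = (h *: e i)%g.
    by move=> i; apply: e_onto; exact: mulH.
  have f_inj : injective f.
    move=> i j fij; apply: e_inj; apply: (can_inj (lcosetK h)).
    by rewrite -!fE fij.
  by exists (perm f_inj) => _ i; rewrite permE.
have [sigma sigmaE] := choice sigma_ex.
exists sigma, e; split=> //.
- by move=> C; split=> [[i <-]//|]; exact: e_onto.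
- by move=> h i hH; exact: sigmaE.
Qed.

Lemma coset_perm_rep_trans n (sigma : gT -> 'S_n) :
  is_coset_perm_rep K H sigma -> forall i j, exists2 h, h \in H & sigma h i = j.
Proof.
move=> [e [e_inj e_im e_sigma]] i j.
have /lcosetsP[x xH ex] : e i \in lcosets K H by apply/e_im; exists i.
have /lcosetsP[y yH ey] : e j \in lcosets K H by apply/e_im; exists j.
exists (y * x^-1)%g; first by rewrite groupM ?groupV.
apply: e_inj; rewrite e_sigma ?groupM ?groupV //.
by rewrite ex ey -lcosetM mulgKV.
Qed.

End CosetRep.

(** The projection H/L -> H/K is equivariant; on enumerated cosets it sends a
    left coset C of L to C K. *)
Lemma coset_perm_rep_quotient (L K H : {group gT}) n m
    (sigma : gT -> 'S_n) (tau : gT -> 'S_m) :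
    is_coset_perm_rep L H sigma -> is_coset_perm_rep K H tau -> L \subset K ->
  exists q : 'I_n -> 'I_m,
    forall h i, h \in H -> q (sigma h i) = tau h (q i).
Proof.
move=> [e [e_inj e_im e_sigma]] [d [d_inj d_im d_tau]] sLK.
have q_ex i : exists j, d j = (e i * K)%g.
  have /lcosetsP[x xH ->] : e i \in lcosets L H by apply/e_im; exists i.
  apply/d_im/lcosetsP; exists x => //.
  by rewrite -mulgA (mulSGid sLK).
have [q qE] := choice q_ex.
exists q => h i hH; apply: d_inj.
by rewrite qE d_tau // qE e_sigma // -!mulgA.
Qed.

End Generated.

(** * Orthogonal representations *)

Section RepTheory.
Variables (R : realType) (gT : finGroupType) (U : orth_rep R gT).
Implicit Types (u v w : U) (g h : gT).

Lemma dotC u v : rep_dot U u v = rep_dot U v u.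
Proof. by rewrite hermC /= expr0 mul1r. Qed.

Lemma dotZl a u v : rep_dot U (a *: u) v = a * rep_dot U u v.
Proof. by rewrite linearZl_LR. Qed.

Lemma dotZr a u v : rep_dot U u (a *: v) = a * rep_dot U u v.
Proof. by rewrite dotC dotZl dotC. Qed.

Lemma dotBl u v w : rep_dot U (u - v) w = rep_dot U u w - rep_dot U v w.
Proof. exact: linearBl. Qed.

Lemma normB_sqr u v :
  `|u - v| ^+ 2 = `|u| ^+ 2 + `|v| ^+ 2 - 2 * rep_dot U u v.
Proof.
rewrite !rep_norm dotBl ![rep_dot U _ (u - v)]dotC !dotBl (dotC v u); ring.
Qed.

Lemma rep_actD g u v : rep_act g (u + v) = rep_act g u + rep_act g v.
Proof. by have := rep_act_linear g 1 u v; rewrite !scale1r. Qed.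

Lemma rep_act0 g : rep_act g (0 : U) = 0.
Proof. by apply: (addIr (rep_act g (0 : U))); rewrite -rep_actD !add0r. Qed.

Lemma rep_actZ g a u : rep_act g (a *: u) = a *: rep_act g u.
Proof. by have := rep_act_linear g a u 0; rewrite rep_act0 !addr0. Qed.

Lemma rep_actB g u v : rep_act g (u - v) = rep_act g u - rep_act g v.
Proof. by rewrite rep_actD -scaleN1r rep_actZ scaleN1r. Qed.

Lemma rep_act_sum g I (r : seq I) (P : pred I) (F : I -> U) :
  rep_act g (\sum_(i <- r | P i) F i) = \sum_(i <- r | P i) rep_act g (F i).
Proof. by apply: big_morph; [exact: rep_actD | exact: rep_act0]. Qed.

Lemma rep_actK g : cancel (@rep_act _ _ U g) (rep_act g^-1%g).
Proof. by move=> u; rewrite -rep_actM mulVg rep_act1. Qed.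

Lemma rep_actKV g : cancel (@rep_act _ _ U g^-1%g) (rep_act g).
Proof. by move=> u; rewrite -rep_actM mulgV rep_act1. Qed.

Lemma norm_rep_act g u : `|rep_act g u| = `|u|.
Proof.
by apply/eqP; rewrite -(@eqrXn2 _ 2) // !rep_norm rep_act_isometry.
Qed.

End RepTheory.

(** * The linear isometries operad *)

Section LinearIsometries.
Variables (R : realType) (gT : finGroupType) (U : orth_rep R gT).

(** The fibres of the equivariant map q : H/L -> H/K all have the same
    cardinality c, so x |-> c^(-1/2) (x o q) is an equivariant isometric
    embedding of the sum of |H : K| copies of U into the sum of |H : L| copies.
    Composing a fixed isometry with it gives a fixed isometry. *)
Lemma lin_isom_transfer_saturated (L K H : {group gT}) :
  L \subset K -> K \subset H ->
  operad_transfer (lin_isom_operad U) L H ->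
  operad_transfer (lin_isom_operad U) K H.
Proof.
move=> sLK sKH [sLH [sigma [rsigma [f [[f_lin f_iso] f_fix]]]]].
have [tau rtau] := coset_perm_rep_exists K H.
split=> //; exists tau; split=> //.
have [q qE] := coset_perm_rep_quotient rsigma rtau sLK.
pose i0 : 'I_(#|H : L|%g) := Ordinal (indexg_gt0 H L).
pose c := #|[pred i | q i == q i0]|.
have c_gt0 : (0 < c)%N by apply/card_gt0P; exists i0; rewrite inE.
have fibre j : #|[pred i | q i == j]| = c.
  have [h hH <-] := coset_perm_rep_trans rtau (q i0) j.
  rewrite /c -!sum1_card [LHS](reindex_inj (@perm_inj _ (sigma h))) /=.
  by apply: eq_bigl => i; rewrite !inE qE // (inj_eq perm_inj).
have sum_q (F : 'I_(#|H : K|%g) -> R) : \sum_i F (q i) = c%:R * \sum_j F j.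
  rewrite (partition_big q xpredT) //= mulr_sumr; apply: eq_bigr => j _.
  rewrite (eq_bigr (fun=> F j)); last by move=> i /eqP->.
  by rewrite sumr_const fibre mulr_natl.
pose a : R := (Num.sqrt c%:R)^-1.
have aa : a * a * c%:R = 1.
  by rewrite -expr2 exprVn sqr_sqrtr ?ler0n // mulVf // pnatr_eq0 -lt0n.
pose y (x : {ffun 'I_(#|H : K|%g) -> U}) := [ffun i => a *: x (q i)].
exists (fun x => f (y x)); split.
  split=> [b x x'|x x'] /=.
    rewrite -f_lin; congr f; apply/ffunP => i; rewrite !ffunE.
    by rewrite scalerDr !scalerA mulrC.
  rewrite f_iso -[RHS]mul1r -aa -mulrA -sum_q mulr_sumr.
  by apply: eq_bigr => i _; rewrite !ffunE dotZl dotZr mulrA.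
move=> _ [h hH <-]; apply/funext => x /=.
rewrite -[RHS](congr1 (@^~ (y x)) (f_fix _ (imageP _ hH))) /=.
rewrite /lin_isom_act; congr (rep_act h (f _)); apply/ffunP => i.
by rewrite !ffunE qE // rep_actZ.
Qed.

End LinearIsometries.

(** * Centres of points of the Steiner operad *)

Section Centres.
Variables (R : realType) (gT : finGroupType) (U : orth_rep R gT).
Implicit Types (V W : fd_subrep U) (u v w : U) (g h : gT).

Lemma subrepP V a u v : subrep_set V u -> subrep_set V v -> subrep_set V (a *: u + v).
Proof.
have [n [b ->]] := subrep_span V; move=> [c _ <-] [d _ <-].
exists (fun i => a * c i + d i) => //.
rewrite scaler_sumr -big_split; apply: eq_bigr => i _.
by rewrite scalerDl scalerA.
Qed.

Lemma subrep0 V : subrep_set V 0.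
Proof.
have [n [b ->]] := subrep_span V; exists (fun=> 0) => //.
by apply: big1 => i _; rewrite scale0r.
Qed.

Lemma subrepZ V a u : subrep_set V u -> subrep_set V (a *: u).
Proof. by move=> Vu; rewrite -[a *: u]addr0; exact/subrepP/subrep0. Qed.

Definition subrep_zero V : V := SigSub (mem_set (subrep0 V)).

(** A vector of V orthogonal to V vanishes, so stabilizing inside V changes
    nothing. *)
Lemma is_stabilization_refl V (f : V -> V) : is_stabilization f f.
Proof.
move=> v w x wV xvw.
have Vw : subrep_set V w.
  have -> : w = -1 *: val v + val x by rewrite xvw scaleN1r addKr.
  by apply: subrepP; exact: set_valP.
have w0 : w = 0.
  apply/eqP; rewrite -normr_eq0 -sqrf_eq0 rep_norm.
  by rewrite (wV (SigSub (mem_set Vw))).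
by rewrite w0 !addr0 in xvw *; congr (val (f _)); apply/val_inj.
Qed.

(** The centre of the i-th embedding is recorded as a vector of U so that
    germs over different V can be compared. *)
Definition germ_centre n (a : steiner_germ U n) (i : 'I_n) : U :=
  val (projT2 a i (itv0 R) (subrep_zero (projT1 a))).

Lemma stabilization_centre V W (f : V -> V) (F : W -> W) :
  is_stabilization f F -> val (F (subrep_zero W)) = val (f (subrep_zero V)).
Proof.
move=> /(_ (subrep_zero V) 0 (subrep_zero W)) /= fF; rewrite fF ?addr0 //.
by move=> v; rewrite linear0r.
Qed.

(** Stabilization fixes the value at the origin, so the centres are defined on
    the colimit. *)
Lemma germ_equiv_centre n (a b : steiner_germ U n) i :
  germ_equiv a b -> germ_centre a i = germ_centre b i.
Proof.
move=> [Z [z [_ _ _ az bz]]]; rewrite /germ_centre.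
rewrite -(stabilization_centre (az i (itv0 R))).
by rewrite -(stabilization_centre (bz i (itv0 R))).
Qed.

Lemma germ_equiv_refl n (a : steiner_germ U n) : germ_pts a -> germ_equiv a a.
Proof.
move=> pa; exists (projT1 a), (projT2 a).
by split=> // i t; exact: is_stabilization_refl.
Qed.

Lemma germ_centre_inj n (a : steiner_germ U n) :
  germ_pts a -> injective (germ_centre a).
Proof.
move=> [_ disj] i j; apply: contraPP => /eqP /disj ij0 /val_inj aij.
suff : set0 (projT2 a i (itv0 R) (subrep_zero (projT1 a))) by [].
by rewrite -ij0; split; [|rewrite aij]; apply: imageT.
Qed.

(** The centres of a fixed point form an H-set isomorphic to H/K; the centre
    indexed by the coset K has stabilizer K. *)
Lemma steiner_transfer_stabilizer (K H : {group gT}) :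
  operad_transfer (steiner_operad U) K H ->
  exists u : U, forall h, h \in H -> rep_act h u = u <-> h \in K.
Proof.
move=> [sKH [sigma [[e [e_inj e_im e_sigma]] [P [[a pa ->] P_fix]]]]].
have centre_act h i : h \in H ->
    rep_act h (germ_centre a i) = germ_centre a (sigma h i).
  (* Invariance of the class P puts h a in the class of a, and equivalent
     germs have equal centres. *)
  move=> hH; pose ha : steiner_germ U _ :=
    existT _ (projT1 a) (steiner_act h (sigma h) (projT2 a)).
  have : [set b | germ_pts b /\ germ_equiv a b] ha.
    have gh : graph_subgroup H sigma (h, sigma h) by exists h.
    rewrite -[X in X ha](P_fix _ gh) /=.
    by exists a => //; split; [|exact: germ_equiv_refl].
  move=> [_ /(germ_equiv_centre (sigma h i)) ->]; rewrite /germ_centre /= /steiner_act.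
  rewrite permK; congr (rep_act h (val (projT2 a i _ _))).
  by apply/val_inj; rewrite /= rep_act0.
have [i ei] : exists i, e i = K :> {set gT}.
  by apply/e_im/lcosetsP; exists 1%g; rewrite ?group1 ?lcoset1 ?mul1g.
exists (germ_centre a i) => h hH; rewrite centre_act //.
have hKi : h \in K <-> sigma h i = i.
  split=> [hK|hi]; first by apply: e_inj; rewrite e_sigma // ei lcoset_id.
  by rewrite -ei -hi e_sigma // ei lcoset_refl.
by split=> [/(germ_centre_inj pa)/hKi//|/hKi->].
Qed.

End Centres.

(** * Embeddings and the compact-open topology *)

Section Embeddings.

(** Continuity of g is only asked at the points of the image of f, because the
    inverse of the radial shrinking below blows up on a sphere. *)
Lemma retraction_embedding (X Y : topologicalType) (f : X -> Y) (g : Y -> X) :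
  continuous f -> cancel f g -> (forall x, {for f x, continuous g}) ->
  topological_embedding f.
Proof.
move=> f_cont fK g_cont; split=> //; first exact: can_inj fK.
move=> A oA; exists (interior (g @^-1` A)); first exact: open_interior.
apply/seteqP; split=> [_ [x Ax <-]|y [/interior_subset + [x _ yE]]].
  split; last exact: imageT.
  by apply: g_cont; rewrite fK; exact: open_nbhs_nbhs.
by rewrite -yE /= fK; exists x.
Qed.

Lemma embedding_comp (X Y Z : topologicalType) (f : X -> Y) (g : Y -> Z) :
  topological_embedding f -> topological_embedding g ->
  topological_embedding (g \o f).
Proof.
move=> [f_inj f_cont f_open] [g_inj g_cont g_open]; split.
- exact: inj_comp.
- by move=> x; apply: continuous_comp; [exact: f_cont|exact: g_cont].
move=> A /f_open[B /g_open[C oC gB] fA]; exists C => //.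
rewrite -image_comp fA; apply/seteqP; split=> [_ [z [Bz [x _ xz]] <-]|].
  rewrite -xz in Bz *; split; last by exists x.
  by have [] : (C `&` range g) (g (f x)) by rewrite -gB; exists (f x).
move=> z [Cz [x _ xz]]; rewrite -xz in Cz *; exists (f x) => //; split=> //.
have : (g @` B) (g (f x)) by rewrite gB; split=> //; exists (f x).
by move=> [y By /g_inj <-].
Qed.

Lemma continuous_at_comp_initial (Y : choiceType) (X Z : topologicalType)
    (w : Y -> Z) (f : X -> initial_topology w) (x : X) :
  {for x, continuous (w \o f)} -> {for x, continuous f}.
Proof.
move=> wf_cont A [_ [[W oW <-] Wfx /filterS]]; apply.
by apply: wf_cont; exact: open_nbhs_nbhs.
Qed.

(** The condition b (h t (a K)) `<=` O says that h t maps the compact set a K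
    into the open set b^-1 O. *)
Lemma compact_open_comp_continuous (T X X' Y Y' : topologicalType)
    (h : T -> X -> X') (a : Y -> X) (b : X' -> Y') :
  continuous (h : T -> {compact-open, X -> X'}) -> continuous a ->
  continuous b ->
  continuous ((fun t => b \o h t \o a) : T -> {compact-open, Y -> Y'}).
Proof.
move=> h_cont a_cont b_cont t; apply/compact_open_cvgP => K O cK oO sKO.
have /compact_open_cvgP hK : h z @[z --> t] --> (h t : {compact-open, X -> X'}).
  exact: h_cont.
have : \forall z \near t, h z @` (a @` K) `<=` b @^-1` O.
  apply: hK.
  - by apply: continuous_compact => //; exact: continuous_subspaceT.
  - by move/continuousP : b_cont; exact.
  - by move=> _ [_ [y Ky <-] <-]; apply: sKO; exists y.
apply: filterS => z sKz _ [y Ky <-].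
by apply: sKz; exists (a y) => //; exists y.
Qed.

End Embeddings.

(** * Radial shrinking onto a ball *)

Section ToBall.
Variables (R : realType) (gT : finGroupType) (U : orth_rep R gT).
Implicit Types (u v w : U) (s : R).

(** For s > 0 this is a homeomorphism from U to the open ball of radius 1/s;
    at s = 0 it degenerates to the identity, so that decreasing s to 0 gives a
    path of embeddings ending at the identity. *)
Definition to_ball s u : U := (1 + s * `|u|)^-1 *: u.
Definition of_ball s u : U := (1 - s * `|u|)^-1 *: u.

Lemma to_ball0 u : to_ball 0 u = u.
Proof. by rewrite /to_ball mul0r addr0 invr1 scale1r. Qed.

Lemma to_ball_den_gt0 s u : 0 <= s -> 0 < 1 + s * `|u|.
Proof. by move=> s0; rewrite ltr_pwDl // mulr_ge0. Qed.

Lemma norm_to_ball s u : 0 <= s -> `|to_ball s u| = `|u| / (1 + s * `|u|).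
Proof.
move=> s0; rewrite normrZ mulrC ger0_norm // invr_ge0.
exact/ltW/to_ball_den_gt0.
Qed.

Lemma norm_to_ball_lt s u : 0 < s -> s * `|to_ball s u| < 1.
Proof.
move=> s0; rewrite norm_to_ball ?ltW // mulrA ltr_pdivrMr ?to_ball_den_gt0 ?ltW //.
by rewrite mul1r ltrDr.
Qed.

Lemma of_ball_den s u : 0 <= s ->
  1 - s * `|to_ball s u| = (1 + s * `|u|)^-1.
Proof.
move=> s0; have := to_ball_den_gt0 u s0; rewrite norm_to_ball // => /gt_eqF/eqP.
by move=> d0; field; apply/eqP.
Qed.

Lemma to_ballK s : 0 <= s -> cancel (to_ball s) (of_ball s).
Proof.
move=> s0 u; rewrite /of_ball of_ball_den // invrK scalerA.
by rewrite mulfV ?scale1r // gt_eqF // to_ball_den_gt0.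
Qed.

(** This uses the inner product: after expanding the squared norms, the
    right side minus the left is affine in the inner product c of u and v with
    a nonpositive slope, so the case of parallel vectors, where c equals
    the product |u| |v|, is the worst one; there it reduces to r |-> r / (1 + s r)
    being 1-Lipschitz for r >= 0. *)
Lemma to_ball_lipschitz s u v : 0 <= s ->
  `|to_ball s u - to_ball s v| <= `|u - v|.
Proof.
move=> s0; rewrite -(@ler_pXn2r _ 2) ?nnegrE // !normB_sqr dotZl dotZr.
have au := to_ball_den_gt0 u s0; have bv := to_ball_den_gt0 v s0.
rewrite !norm_to_ball //.
have cs : 2 * rep_dot U u v <= 2 * (`|u| * `|v|).
  have : (`|u| - `|v|) ^+ 2 <= `|u - v| ^+ 2.
    rewrite -[leLHS]real_normK ?num_real // ler_pXn2r ?nnegrE //.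
    exact: ler_dist_dist.
  rewrite normB_sqr sqrrB; lra.
have p0 := normr_ge0 u; have q0 := normr_ge0 v.
set p := `|u| in au cs p0 *; set q := `|v| in bv cs q0 *.
set a := (1 + s * p)^-1; set b := (1 + s * q)^-1.
have a01 : 0 <= a <= 1.
  by rewrite invr_ge0 ltW //= invf_le1 // lerDl mulr_ge0 //.
have b01 : 0 <= b <= 1.
  by rewrite invr_ge0 ltW //= invf_le1 // lerDl mulr_ge0 //.
have pq : p * a - q * b = (p - q) * (a * b).
  by rewrite /a /b; field; rewrite !gt_eqF.
have ab1 : 0 <= a * b <= 1.
  by case/andP: a01 => ? ?; case/andP: b01 => ? ?; rewrite mulr_ge0 //= mulr_ile1.
set k := a * b in pq ab1 *; set c := rep_dot U u v in cs *.
have -> : (p * a) ^+ 2 + (q * b) ^+ 2 - 2 * (a * (b * c)) =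
    ((p - q) * k) ^+ 2 + 2 * k * (p * q - c).
  rewrite -pq /k; ring.
rewrite -subr_ge0.
have -> : p ^+ 2 + q ^+ 2 - 2 * c - (((p - q) * k) ^+ 2 + 2 * k * (p * q - c)) =
    (p - q) ^+ 2 * (1 - k ^+ 2) + 2 * (1 - k) * (p * q - c) by ring.
case/andP: ab1 => k0 k1; apply: addr_ge0.
  by rewrite mulr_ge0 ?sqr_ge0 // subr_ge0 expr_le1.
by rewrite !mulr_ge0 ?subr_ge0 // -(@ler_pM2l _ 2).
Qed.

End ToBall.

(** * The action on the Steiner operad *)

Section SteinerAction.
Variables (R : realType) (gT : finGroupType) (U : orth_rep R gT).
Implicit Types (V W : fd_subrep U) (u v w : U) (g h : gT).

Lemma rep_act_continuous g : continuous (@rep_act _ _ U g).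
Proof.
move=> u; apply/cvgrPdist_le => e e0; near=> v.
rewrite -rep_actB norm_rep_act; near: v.
by apply: cvgr_dist_le => //; exact: cvg_id.
Unshelve. all: by end_near. Qed.

Lemma val_continuous V : continuous (val : V -> U).
Proof. exact: (@initial_continuous _ _ set_val). Qed.

Lemma subrep_act_continuous V g : continuous (@subrep_act _ _ U V g).
Proof.
apply: continuous_comp_initial => v.
apply: (@continuous_comp V U U val (rep_act g)).
  exact: val_continuous.
by exact: rep_act_continuous.
Qed.

Lemma subrep_actK V g : cancel (@subrep_act _ _ U V g) (subrep_act g^-1%g).
Proof. by move=> v; apply/val_inj; rewrite /= rep_actK. Qed.

Lemma subrep_actKV V g : cancel (@subrep_act _ _ U V g^-1%g) (subrep_act g).
Proof. by move=> v; apply/val_inj; rewrite /= rep_actKV. Qed.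

Lemma subrep_act_embedding V g : topological_embedding (@subrep_act _ _ U V g).
Proof.
apply: (@retraction_embedding _ _ _ (subrep_act g^-1%g)).
- exact: subrep_act_continuous.
- exact: subrep_actK.
- by move=> v; exact: subrep_act_continuous.
Qed.

(** Conjugating by an isometry preserves all the conditions on a point. *)
Lemma steiner_pts_act V n g (s : 'S_n) (h : 'I_n -> @unit_itv R -> V -> V) :
  steiner_pts h -> steiner_pts (steiner_act g s h).
Proof.
move=> [h_path h_disj]; split=> [i|i j ij].
  have [h_maps h_cont h1] := h_path ((s^-1)%g i); split.
  - move=> t; have [h_emb h_dist] := h_maps t; split.
      apply: (@embedding_comp _ _ _ (h (s^-1%g i) t \o subrep_act g^-1%g)
        (subrep_act g)).
        by apply: embedding_comp => //; exact: subrep_act_embedding.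
      exact: subrep_act_embedding.
    move=> v w; rewrite /= -rep_actB norm_rep_act.
    by apply: le_trans (h_dist _ _) _; rewrite /= -rep_actB norm_rep_act.
  - exact: (compact_open_comp_continuous h_cont (@subrep_act_continuous V g^-1%g)
      (@subrep_act_continuous V g)).
  - by apply/funext => v; rewrite /steiner_act h1 /= subrep_actKV.
have /h_disj ij0 : (s^-1)%g i != (s^-1)%g j by rewrite (inj_eq perm_inj).
apply/seteqP; split=> // v [[x _ <-] [y _]].
move=> /(can_inj (@subrep_actK V g)) xy.
suff : set0 (h ((s^-1)%g i) (itv0 R) (subrep_act g^-1%g x)) by [].
by rewrite -ij0; split; [|rewrite -xy]; exact: imageT.
Qed.

Lemma is_stabilization_act V W g (f : V -> V) (F : W -> W) :
  is_stabilization f F ->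
  is_stabilization (subrep_act g \o f \o subrep_act g^-1%g)
                   (subrep_act g \o F \o subrep_act g^-1%g).
Proof.
move=> fF v w x wV xvw.
rewrite /= (fF (subrep_act g^-1%g v) (rep_act g^-1%g w)) ?rep_actD ?rep_actKV //.
  move=> v'; rewrite -(rep_act_isometry g) rep_actKV.
  exact: (wV (subrep_act g v')).
by rewrite /= xvw rep_actD.
Qed.

Definition germ_act n g (s : 'S_n) (a : steiner_germ U n) : steiner_germ U n :=
  existT _ (projT1 a) (steiner_act g s (projT2 a)).

Lemma germ_equiv_act n g (s : 'S_n) (a b : steiner_germ U n) :
  germ_equiv a b -> germ_equiv (germ_act g s a) (germ_act g s b).
Proof.
move=> [Z [z [aZ bZ pz az bz]]]; exists Z, (steiner_act g s z).
split=> //; first exact: steiner_pts_act.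
- by move=> i t; exact: is_stabilization_act (az _ _).
- by move=> i t; exact: is_stabilization_act (bz _ _).
Qed.

Lemma steiner_actKV V n g (s : 'S_n) :
  cancel (@steiner_act _ _ _ V n g^-1%g (s^-1)%g) (steiner_act g s).
Proof.
move=> h; apply/funext => i; apply/funext => t; apply/funext => v.
apply/val_inj; rewrite /= rep_actKV permK.
by congr (val (h i t _)); apply/val_inj; rewrite /= rep_actK.
Qed.

Lemma germ_actKV n g (s : 'S_n) :
  cancel (germ_act g^-1%g (s^-1)%g) (germ_act g s).
Proof. by move=> [V h]; rewrite /germ_act /= steiner_actKV. Qed.

Lemma germ_actK n g (s : 'S_n) :
  cancel (germ_act g s) (germ_act g^-1%g (s^-1)%g).
Proof. by move=> a; rewrite -{2}(germ_actKV g^-1%g s^-1%g a) !invgK. Qed.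

(** Since the action preserves equivalence of germs, a class with an invariant
    representative is invariant; the reverse inclusion comes from applying the
    inverse group element. *)
Lemma steiner_colim_act_fixed n g (s : 'S_n) (a : steiner_germ U n) :
  germ_act g s a = a ->
  steiner_colim_act g s [set b | germ_pts b /\ germ_equiv a b] =
  [set b | germ_pts b /\ germ_equiv a b].
Proof.
move=> a_fix; apply/seteqP; split=> [_ [b [pb ab] <-]|b [pb ab]] /=.
  split; first exact: steiner_pts_act.
  by rewrite -[X in germ_equiv X]a_fix; exact: germ_equiv_act.
exists (germ_act g^-1%g (s^-1)%g b); last exact: germ_actKV.
split; first exact: steiner_pts_act.
by rewrite -(germ_actK g s a) a_fix; exact: germ_equiv_act.
Qed.

Section OrbitSpan.
Variable u : U.

(** The orbit is enumerated with repetitions by the elements of the group, which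
    avoids a choice of coset representatives of the stabilizer. *)
Definition orbit_span_set : set U :=
  [set \sum_(i < #|gT|) c i *: rep_act (enum_val i) u | c in [set: 'I_(#|gT|) -> R]].

Lemma orbit_span_stable g v : orbit_span_set v -> orbit_span_set (rep_act g v).
Proof.
move=> [c _ <-]; exists (fun i => c (enum_rank (g^-1 * enum_val i)%g)) => //.
pose r (i : 'I_(#|gT|)) : 'I_(#|gT|) := enum_rank (g * enum_val i)%g.
have r_inj : injective r by move=> i j /enum_rank_inj/mulgI/enum_val_inj.
rewrite (reindex_inj r_inj) rep_act_sum; apply: eq_bigr => i _.
by rewrite /r enum_rankK mulKg enum_valK rep_actZ rep_actM.
Qed.

Definition orbit_span : fd_subrep U :=
  @FdSubrep _ _ U orbit_span_set
    (ex_intro _ #|gT| (ex_intro _ (fun i => rep_act (enum_val i) u) erefl))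
    orbit_span_stable.

Lemma mem_orbit_span g : subrep_set orbit_span (rep_act g u).
Proof.
exists (fun i => (i == enum_rank g)%:R) => //.
rewrite (bigD1 (enum_rank g)) //= eqxx scale1r enum_rankK big1 ?addr0 // => i.
by move=> /negPf->; rewrite scale0r.
Qed.

End OrbitSpan.

End SteinerAction.

(** * Steiner paths shrinking towards a point *)

Section Shrink.
Variables (R : realType) (gT : finGroupType) (U : orth_rep R gT).
Variables (V : fd_subrep U) (M : R) (c : V).
Hypothesis M_ge0 : 0 <= M.
Implicit Types (t : @unit_itv R) (x y : V).

Let time t := 1 - val t.

Lemma time_ge0 t : 0 <= time t.
Proof.
have := set_valP t; rewrite /unit_itv /= in_itv /= => /andP[_].
by rewrite subr_ge0.
Qed.

Lemma shrink_subproof t x :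
  time t *: val c + to_ball (time t * M) (val x) \in subrep_set V.
Proof. by rewrite inE; apply: subrepP; [|apply: subrepZ]; exact: set_valP. Qed.

(** For M > 0 the image at time 0 lies in the ball of radius 1/M about c, and at time 1
    the map is the identity.  Moving the centre and the radius simultaneously gives
    a single formula, so joint continuity in (t, x) is immediate. *)
Definition shrink t x : V := SigSub (shrink_subproof t x).

Lemma unshrink_subproof t x :
  of_ball (time t * M) (val x - time t *: val c) \in subrep_set V.
Proof.
rewrite inE addrC -scaleNr.
by apply/subrepZ/subrepP; exact: set_valP.
Qed.

Definition unshrink t x : V := SigSub (unshrink_subproof t x).

Lemma shrinkK t : cancel (shrink t) (unshrink t).
Proof.
move=> x; apply/val_inj; rewrite /= addrC addKr to_ballK //.
by rewrite mulr_ge0 // time_ge0.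
Qed.

Lemma shrink_continuous :
  continuous (fun tx : @unit_itv R * V => shrink tx.1 tx.2).
Proof.
apply: continuous_comp_initial => -[t x].
have time_cvg : time tx.1 @[tx --> (t, x)] --> time t.
  apply: cvgB; first exact: cvg_cst.
  apply: (@cvg_comp _ _ _ fst (val : @unit_itv R -> R)); first exact: cvg_fst.
  exact: (@initial_continuous _ _ set_val).
have val_cvg : val tx.2 @[tx --> (t, x)] --> val x.
  apply: (@cvg_comp _ _ _ snd (val : V -> U)); first exact: cvg_snd.
  exact: val_continuous.
apply: cvgD; first by apply: cvgZ => //; exact: cvg_cst.
apply: cvgZ => //; apply: cvgV.
  by rewrite gt_eqF // to_ball_den_gt0 // mulr_ge0 // time_ge0.
apply: cvgD; first exact: cvg_cst.
apply: cvgM; last exact: cvg_norm.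
by apply: cvgM => //; exact: cvg_cst.
Qed.

Lemma unshrink_continuous t x : {for shrink t x, continuous (unshrink t)}.
Proof.
set s := time t * M; have s_ge0 : 0 <= s by rewrite mulr_ge0 // time_ge0.
have inner_cont : continuous (fun y : V => val y - time t *: val c).
  move=> y; apply: (@cvgB _ _ _ (nbhs y)); first exact: val_continuous.
  exact: cvg_cst.
have outer_cont : {for to_ball s (val x), continuous (@of_ball _ _ U s)}.
  apply: cvgZ => //; apply: cvgV.
    by rewrite of_ball_den // invr_neq0 // gt_eqF // to_ball_den_gt0.
  apply: cvgB; first exact: cvg_cst.
  by apply: cvgM; [exact: cvg_cst | exact: cvg_norm].
have inner_x : val (shrink t x) - time t *: val c = to_ball s (val x).
  by rewrite /= addrC addKr.
apply: (@continuous_at_comp_initial _ _ _ set_val).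
apply: (@continuous_comp V U U _ (@of_ball _ _ U s)); first exact: inner_cont.
by rewrite inner_x.
Qed.

(** Joint continuity in (t, x) yields continuity in t for the compact-open
    topology by currying. *)
Lemma shrink_path : steiner_path shrink.
Proof.
split=> [t||].
- split.
    apply: (@retraction_embedding _ _ _ (unshrink t)).
    + by have [_] := continuous_curry shrink_continuous; exact.
    + exact: shrinkK.
    + exact: unshrink_continuous.
  move=> x y /=; rewrite opprD addrACA subrr add0r.
  by apply: to_ball_lipschitz; rewrite mulr_ge0 // time_ge0.
- exact: continuous_curry_fun shrink_continuous.
apply/funext => x; apply/val_inj.
by rewrite /= /time subrr mul0r scale0r add0r to_ball0.
Qed.

End Shrink.

(** * Stabilizers and the Steiner transfer system *)

Section Transfer.
Variables (R : realType) (gT : finGroupType) (U : orth_rep R gT).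

(** Let v_i be the points of the orbit H u, indexed by H/K.  The paths shrinking
    the span of G u towards the v_i at a common rate M depend equivariantly on
    their centres, since the radial shrinking commutes with isometries.  For M
    large the balls of radius 1/M about the v_i are disjoint. *)
Lemma stabilizer_steiner_transfer (K H : {group gT}) (u : U) : K \subset H ->
  (forall h, h \in H -> rep_act h u = u <-> h \in K) ->
  operad_transfer (steiner_operad U) K H.
Proof.
move=> sKH stab_u; split=> //.
have [tau rtau] := coset_perm_rep_exists K H.
exists tau; split=> //.
have [e [e_inj e_im e_tau]] := rtau.
have /choice[r rE] : forall i, exists x, x \in H /\ e i = (x *: K)%g.
  move=> i; have /lcosetsP[x xH ->] : e i \in lcosets K H by apply/e_im; exists i.
  by exists x.
pose v i := rep_act (r i) u.
have v_act h i : h \in H -> rep_act h (v i) = v (tau h i).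
  move=> hH; have : r (tau h i) \in ((h * r i)%g *: K)%g.
    rewrite lcosetM -(rE i).2 -e_tau // (rE _).2; exact: lcoset_refl.
  move=> /lcosetP[k kK rk]; rewrite /v rk !rep_actM.
  by rewrite ((stab_u k (fintype.subsetP sKH _ kK)).2 kK).
have v_inj : injective v.
  move=> i j vij; apply: e_inj; rewrite (rE i).2 (rE j).2.
  apply/lcoset_eqP; rewrite mem_lcoset; apply/stab_u.
    by rewrite groupM ?groupV //; [case: (rE j)|case: (rE i)].
  by rewrite rep_actM -/(v i) vij rep_actK.
pose V := orbit_span u.
pose c i : V := SigSub (mem_set (mem_orbit_span u (r i))).
(* This sum dominates each 2 / |v_i - v_j|, so that M |v_i - v_j| >= 2. *)
pose M : R := 1 + \sum_i \sum_j 2 / `|v i - v j|.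
have d_ge0 i j : 0 <= 2 / `|v i - v j| by rewrite divr_ge0.
have M_gt0 : 0 < M by rewrite ltr_pwDl // sumr_ge0 // => i _; exact: sumr_ge0.
have M_sep i j : i != j -> 2 <= M * `|v i - v j|.
  move=> ij; rewrite -ler_pdivrMr; last first.
    by rewrite normr_gt0 subr_eq0 (inj_eq v_inj).
  rewrite /M (bigD1 i) //= (bigD1 j) //= addrCA -addrA lerDl !addr_ge0 //.
    by apply: sumr_ge0.
  by apply: sumr_ge0 => k _; exact: sumr_ge0.
pose p i := shrink M (c i).
have p_pts : steiner_pts p.
  split=> [i|i j ij]; first exact/shrink_path/ltW.
  apply/seteqP; split=> // _ [[x _ <-] [y _ /(congr1 val)]] /=.
  rewrite subr0 !mul1r !scale1r => vxy.
  have : v i - v j = to_ball M (val y) - to_ball M (val x).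
    by rewrite -[v i](addrK (to_ball M (val x))) -vxy addrAC [v j + _]addrC addrK.
  have := M_sep i j ij.
  have := norm_to_ball_lt (val x) M_gt0; have := norm_to_ball_lt (val y) M_gt0.
  move=> yM xM + vij; rewrite vij.
  have := ler_wpM2l (ltW M_gt0) (ler_normB (to_ball M (val y)) (to_ball M (val x))).
  lra.
pose a : steiner_germ U #|H : K|%g := existT _ V p.
exists [set b | germ_pts b /\ germ_equiv a b]; split; first by exists a.
move=> _ [h hH <-]; apply: steiner_colim_act_fixed; congr existT.
apply/funext => i; apply/funext => t; apply/funext => x; apply/val_inj.
rewrite /= rep_actD !rep_actZ.
rewrite -/(v _) v_act // permKV.
by rewrite norm_rep_act rep_actKV.
Qed.

End Transfer.

(** * Vectors with intermediate stabilizer *)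

Section Intermediate.
Variables (R : realType) (gT : finGroupType) (U : orth_rep R gT).
Variables (p : nat) (E : {group gT}) (u : U).
Hypotheses (p_pr : prime p) (E_abelem : (p.-abelem E)%g).

Let cyclic_sum (x : gT) : U := \sum_(i < p) rep_act (x ^+ i)%g u.
Let E_sum : U := \sum_(x in E) rep_act x u.

Lemma E_sum_fixed h : h \in E -> rep_act h E_sum = E_sum.
Proof.
move=> hE; rewrite rep_act_sum [RHS](reindex_inj (mulgI h)).
by apply: eq_big => [x|x _]; rewrite ?groupMl // rep_actM.
Qed.

Lemma cyclic_sum_fixed x : x \in E -> rep_act x (cyclic_sum x) = cyclic_sum x.
Proof.
move=> xE; have xp : (x ^+ p = 1)%g by have [_ ->] := abelemP p_pr E_abelem.
rewrite /cyclic_sum rep_act_sum.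
under eq_bigr do rewrite -rep_actM -expgS.
have p_gt0 := prime_gt0 p_pr.
by rewrite -(prednK p_gt0) big_ord_recr big_ord_recl /= prednK // xp addrC.
Qed.

(** As k is prime to the order of E, x |-> x^k permutes E. *)
Lemma sum_power k : (0 < k < p)%N ->
  \sum_(x in E) rep_act (x ^+ k)%g u = E_sum.
Proof.
move=> /andP[k_gt0 k_lt].
have co_Ek : coprime #|E| k.
  rewrite (card_pgroup (abelem_pgroup E_abelem)) coprimeXl // prime_coprime //.
  by rewrite gtnNdvd.
have powI : {in E &, injective (fun x : gT => x ^+ k)%g}.
  exact: can_in_inj (expgK co_Ek).
have powE : [set (x ^+ k)%g | x in E]%SET = E.
  apply/eqP; rewrite eqEcard (card_in_imset powI) leqnn andbT.
  by apply/fintype.subsetP => _ /imsetP[x xE ->]; exact: groupX.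
by rewrite /E_sum -[in RHS]powE big_imset.
Qed.

(** After exchanging the sums, the exponent 0 contributes |E| copies of u, and
    each of the p - 1 other exponents contributes the sum over E. *)
Lemma sum_cyclic_sum :
  \sum_(x in E) cyclic_sum x = u *+ #|E| + E_sum *+ p.-1.
Proof.
rewrite /cyclic_sum exchange_big /=.
have p_gt0 := prime_gt0 p_pr.
rewrite -(prednK p_gt0) big_ord_recl /=; congr (_ + _).
  by under eq_bigr do rewrite expg0 rep_act1; rewrite sumr_const.
rewrite (eq_bigr (fun=> E_sum)); first by rewrite sumr_const card_ord.
by move=> i _; apply: sum_power; rewrite /= -[X in (_ < X)%N](prednK p_gt0) ltnS.
Qed.

(** If cyclic_sum x were fixed by E for every x <> 1, then by sum_cyclic_sum, in
    which the term x = 1 is p u, so would be (|E| - p) u, and hence u; but u is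
    moved by every h <> 1. *)
Lemma intermediate_stabilizer : (p < #|E|)%N ->
  (forall h, h \in E -> rep_act h u = u -> h = 1%g) ->
  exists (K : {group gT}) (w : U),
    [/\ K \subset E, K <> 1%G, K <> E &
        forall h, h \in E -> rep_act h w = w <-> h \in K].
Proof.
move=> pE u_free.
have [x [xE x1 [h0 hE h0x]]] : exists x, [/\ x \in E, x != 1%g &
    exists2 h, h \in E & rep_act h (cyclic_sum x) <> cyclic_sum x].
  apply: contrapT => no_x.
  have fixed x h : x \in E -> x != 1%g -> h \in E ->
      rep_act h (cyclic_sum x) = cyclic_sum x.
    move=> xE x1 hE; apply: contrapT => xh; apply: no_x; exists x.
    by split=> //; exists h.
  have u_fixed h : h \in E -> rep_act h u = u.
    move=> hE; pose S := \sum_(x in E | x != 1%g) cyclic_sum x.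
    have Sh : rep_act h S = S.
      rewrite rep_act_sum; apply: eq_bigr => x /andP[xE x1]; exact: fixed.
    have uS : u *+ (#|E| - p) = S - E_sum *+ p.-1.
      have := sum_cyclic_sum; rewrite (bigD1 1%g) //= -/S.
      have -> : cyclic_sum 1%g = u *+ p.
        rewrite /cyclic_sum; under eq_bigr do rewrite expg1n rep_act1.
        by rewrite sumr_const card_ord.
      rewrite -[in u *+ #|E|](subnKC (ltnW pE)) mulrnDr -addrA => /addrI ->.
      by rewrite addrK.
    have natE (v : U) n : v *+ n = n%:R *: v by rewrite scaler_nat.
    have : rep_act h (u *+ (#|E| - p)) = u *+ (#|E| - p).
      by rewrite uS rep_actB Sh natE rep_actZ E_sum_fixed.
    rewrite natE rep_actZ; apply: scalerI.
    by rewrite pnatr_eq0 -lt0n subn_gt0.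
  have E1 : E \subset [1 gT]%g.
    by apply/fintype.subsetP => h hE; rewrite inE (u_free h) // u_fixed.
  have := subset_leq_card E1; rewrite cards1 leqNgt (leq_trans _ pE) //.
  by rewrite ltnS prime_gt0.
have gK : group_set [set h in E | rep_act h (cyclic_sum x) == cyclic_sum x]%SET.
  apply/group_setP; split=> [|a b]; first by rewrite inE group1 rep_act1 eqxx.
  rewrite !inE => /andP[aE /eqP ax] /andP[bE /eqP bx].
  by rewrite groupM //= rep_actM bx ax.
exists (Group gK), (cyclic_sum x); split.
- by apply/fintype.subsetP => h; rewrite inE => /andP[].
- move=> K1; have : x \in Group gK by rewrite inE xE cyclic_sum_fixed /=.
  by rewrite K1 inE (negPf x1).
- by move=> KE; move: hE; rewrite -KE inE => /andP[_ /eqP].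
- by move=> h hE'; rewrite inE hE' /=; split=> [->|/eqP].
Qed.

End Intermediate.

Theorem theorem4p15 (gT : finGroupType)
    (G_abelian : abelian [set: gT]%G) (G_noncyclic : ~~ cyclic [set: gT]%G)
    (R : realType) (U : orth_rep R gT) (U_univ : G_universe U) :
  transfer_generated (pair_relation 1%G [set: gT]%G) <> operad_transfer (steiner_operad U) /\
  transfer_generated (pair_relation 1%G [set: gT]%G) <> operad_transfer (lin_isom_operad U).
Proof.
have gen1G : transfer_generated (pair_relation 1%G [set: gT]%G) 1%G [set: gT]%G.
  exact: sub_transfer_generated.
split=> genE; move: (gen1G); rewrite genE.
  move=> /steiner_transfer_stabilizer[u u_free].
  have [p p_pr pG] := rank_witness [set: gT]%G.
  have /p_rank_geP[E /pnElemP[_ E_abelem logE]] : (2 <= 'r_p([set: gT]%G)%g)%N.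
    by rewrite -pG ltnNge -abelian_rank1_cyclic.
  have pE : (p < #|E|)%N.
    rewrite (card_pgroup (abelem_pgroup E_abelem)) logE.
    by rewrite -{1}[p]expn1 ltn_exp2l // prime_gt1.
  have [|K [w [sKE K1 KE stab_w]]] := intermediate_stabilizer p_pr E_abelem pE (u := u).
    by move=> h _ hu; apply/set1gP/(u_free h _).1; rewrite ?inE.
  have := stabilizer_steiner_transfer sKE stab_w; rewrite -genE.
  by move=> /transfer_generated_trivial[].
move=> lin1G.
(* The intermediate subgroup is the cyclic group of any x <> 1. *)
have [G1|/trivgPn[x _ x1]] := eqVneq [set: gT]%SET 1%g.
  by move: G_noncyclic; rewrite /= G1 cyclic1.
have := lin_isom_transfer_saturated (sub1G <[x]>%G) (finset.subsetT _) lin1G.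
rewrite -genE => /transfer_generated_trivial[] /(congr1 val) /= xE.
  by move: G_noncyclic; rewrite /= -xE cycle_cyclic.
by move: x1; rewrite -cycle_eq1 xE eqxx.
Qed.
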